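(* Let $N\geq 2$ be an integer that is not a multiple of $3$, and let $x^\star$ be a stationary point of the constrained potential $V_0|_S$ with triple $(a_0,a_1,a_2)$. Then: (i) if $2a_1>a_0+a_2$, then $x^\star$ is a stationary point of index $a_0$; (ii) if $2a_1<a_0+a_2$, then $x^\star$ is a stationary point of index $a_2-1$.
   Context: Let $V_0:\mathbb{R}^N\to\mathbb{R}$, $V_0(x)=\sum_{i=1}^N\bigl(\tfrac14x_i^4-\tfrac12x_i^2\bigr)$, and $S=\{x\in\mathbb{R}^N:\sum_{i=1}^Nx_i=0\}$. A stationary (critical) point of the constrained potential is a point $x\in S$ that is critical for $V_0|_S$, i.e. $\nabla V_0(x)=\lambda(1,\dots,1)^T$ for some Lagrange multiplier $\lambda\in\mathbb{R}$; in components, $x_i^3-x_i=\lambda$ for all $i$. Its index is the number of negative eigenvalues of the Hessian of $V_0|_S$ (a quadratic form on the $(N-1)$-dimensional space $S$) at that point. Triple of a stationary point: when $N$ is not a multiple of $3$, every stationary point has $|\lambda|<\frac{2}{3\sqrt3}$, so that $\xi^3-\xi-\lambda$ has three distinct real roots $\alpha_0,\alpha_1,\alpha_2$, and each coordinate $x_i$ is one of them. Let $a_j$ be the number of coordinates equal to $\alpha_j$ (possibly $0$), the roots being numbered so that $a_0\leq a_1\leq a_2$. Then $(a_0,a_1,a_2)$ is called the triple of the point; one has $a_0+a_1+a_2=N$. *)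

(* Defs.v *)
From HB Require Import structures.
From mathcomp Require Import all_boot all_order all_algebra.
From mathcomp Require Import all_classical all_reals all_analysis.

Set Implicit Arguments.
Unset Strict Implicit.
Unset Printing Implicit Defensive.

Import Order.TTheory GRing.Theory Num.Theory.
Import numFieldNormedType.Exports.

Local Open Scope classical_set_scope.
Local Open Scope ring_scope.

Section constrained_potential.
Context {R : realType}.

Section fixed_dimension.
Context {N : nat}.
Implicit Types (f : 'rV[R]_N -> R) (x : 'rV[R]_N) (mu : R).

Definition V0 x : R := \sum_(i < N) (4^-1 * x 0 i ^+ 4 - 2^-1 * x 0 i ^+ 2).

Definition zero_sum : set 'rV[R]_N := [set x | \sum_(i < N) x 0 i = 0].

Definition gradient f x : 'rV[R]_N :=
  \row_(i < N) 'D_(delta_mx 0 i) f x.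

Definition hessian f x : 'M[R]_N :=
  \matrix_(i < N, j < N) 'D_(delta_mx 0 i) ('D_(delta_mx 0 j) f) x.

Definition is_multiplier x (lambda : R) : Prop :=
  gradient V0 x = const_mx lambda.

Definition stationary x : Prop :=
  zero_sum x /\ exists lambda : R, is_multiplier x lambda.

Definition multiplier_poly (lambda : R) : {poly R} :=
  'X^3 - 'X - lambda%:P.

(* The inequalities between the counts only constrain the numbering of the
   roots; when counts coincide several numberings are allowed, but the numbers
   a0, a1, a2 do not depend on the choice. *)
Definition has_triple x (a0 a1 a2 : nat) : Prop :=
  exists lambda alpha0 alpha1 alpha2 : R,
    [/\ is_multiplier x lambda,
        uniq [:: alpha0; alpha1; alpha2]
          /\ all (root (multiplier_poly lambda)) [:: alpha0; alpha1; alpha2],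
        [/\ a0 = #|[set i | x 0 i == alpha0]|%SET,
            a1 = #|[set i | x 0 i == alpha1]|%SET &
            a2 = #|[set i | x 0 i == alpha2]|%SET] &
        (a0 <= a1 <= a2)%N].

Definition zero_summx : 'M[R]_N := kermx (const_mx 1 : 'cV[R]_N).

Lemma zero_summxP x : (x <= zero_summx)%MS <-> zero_sum x.
Proof.
have E : (x *m (const_mx 1 : 'cV[R]_N)) = (\sum_(i < N) x 0 i)%:M.
  apply/matrixP => i j; rewrite !ord1 !mxE eqxx mulr1n.
  by apply: eq_bigr => k _; rewrite mxE mulr1.
split=> [/sub_kermxP|Sx]; last by apply/sub_kermxP; rewrite E Sx raddf0.
by rewrite E => /matrixP/(_ 0 0); rewrite !mxE eqxx mulr1n.
Qed.

(* Orthogonal projection of R^N onto zero_sum. *)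
Definition zero_sum_proj : 'M[R]_N := 1%:M - const_mx N%:R^-1.

(* The quadratic form v |-> v *m hessian V0 x *m v^T on the Euclidean space
   zero_sum is represented by the self-adjoint endomorphism
   v |-> v *m hessian V0 x *m zero_sum_proj of zero_sum; this is its
   eigenspace for mu. *)
Definition constrained_eigenspace x mu : 'M[R]_N :=
  (zero_summx :&: eigenspace (hessian V0 x *m zero_sum_proj) mu)%MS.

(* Number of negative eigenvalues, counted with multiplicity. The sum has
   finite support. *)
Definition hessian_index x : nat :=
  \big[addn/0%N]_(mu \in [set mu : R | mu < 0])
    \rank (constrained_eigenspace x mu).

End fixed_dimension.
End constrained_potential.

(* Main.v *)
Require Import Defs.
From mathcomp Require Import all_boot all_order all_algebra.
From mathcomp Require Import all_classical all_reals all_analysis.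
From mathcomp Require Import zify ring lra.

(** Write [h(xi) = 3 xi^2 - 1]. The Hessian of [V0] at [x] is diagonal with
    entries [h(x_i)], and if [alpha0, alpha1, alpha2] are the roots of the
    multiplier polynomial, then [h(alpha_j)] is the derivative of that
    polynomial at [alpha_j], the product of the two differences
    [alpha_j - alpha_k]. So [h] is negative at the middle root and positive at
    the two extreme ones. Since [alpha0 + alpha1 + alpha2 = 0] and
    [a0 alpha0 + a1 alpha1 + a2 alpha2 = 0], the roots are proportional to
    [a1 - a2, a2 - a0, a0 - a1] ([triple_roots]). These three numbers do not
    all vanish, since [a0 = a1 = a2] would make [N] a multiple of 3. With
    [a0 <= a1 <= a2], the middle root is [alpha0] if [2 a1 > a0 + a2] and
    [alpha2] if [2 a1 < a0 + a2].

    There remains the loss of negative directions caused by restricting the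
    form to the hyperplane of zero-sum vectors. A vector [v] of the hyperplane
    is an eigenvector for [mu] of the restriction of a diagonal form [d] when
    [(d_i - mu) v_i] does not depend on [i] ([diag_eigenspaceP]). If [mu] is an
    entry of [d] of multiplicity [k], its eigenspace has dimension [k - 1]
    ([rank_diag_eigenspace_entry]); the other eigenvalues are simple, and are
    the roots of the secular function [sum_i (d_i - mu)^-1]
    ([rank_diag_eigenspace_regular]). When all the negative entries equal the
    same [m], of multiplicity [k > 0], that function is positive to the left of
    [m], and increases from minus infinity to [sum_i d_i^-1] between [m] and
    [0], so the number of its negative roots is decided by the sign of the
    latter sum: the index is [k] if the sum is positive ([diag_index_pos]) and
    [k - 1] if it is negative ([diag_index_neg]). For the Hessian the sum can be
    computed from the triple ([sum_inv_triple]): it has the sign of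
    [2 a1 - a0 - a2]. *)

Set Implicit Arguments.
Unset Strict Implicit.
Unset Printing Implicit Defensive.

Import Order.TTheory GRing.Theory Num.Theory.
Import numFieldNormedType.Exports.

Local Open Scope classical_set_scope.
Local Open Scope ring_scope.

(** * First and second derivatives of the potential *)

Section derivatives.
Context {R : realType} {N : nat}.
Implicit Types x v : 'rV[R]_N.

Lemma is_derive_coord x v (i : 'I_N) :
  is_derive x v (fun y : 'rV[R]_N => y 0 i) (v 0 i).
Proof.
have @f : {linear 'rV[R]_N -> R}.
  by exists (fun y : 'rV[R]_N => y 0 i); do 2![eexists]; do ?[constructor];
     rewrite ?mxE// => ? *; rewrite ?mxE//; move=> ?; rewrite !mxE.
rewrite (_ : (fun _ => _) = f) //.
have fc : continuous f by exact: coord_continuous.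
have fd : differentiable f x by exact: linear_differentiable.
by apply: DeriveDef; [exact: diff_derivable | rewrite deriveE// diff_lin].
Qed.

Lemma gradient_V0E x : gradient V0 x = \row_i (x 0 i ^+ 3 - x 0 i).
Proof.
apply/rowP => i; rewrite !mxE.
have -> : @V0 R N = \sum_(j < N) (4^-1 \*: (fun y : 'rV[R]_N => y 0 j) ^+ 4
    - 2^-1 \*: (fun y : 'rV[R]_N => y 0 j) ^+ 2).
  by apply/funext => y; rewrite fct_sumE; apply: eq_bigr.
have D := fun j => is_derive_coord x (delta_mx 0 i) j.
apply: derive_val; apply: is_derive_eq.
rewrite (bigD1 i) //= big1 => [|j ji]; rewrite !mxE ?eqxx ?(negPf ji) /=
  ?scaler0 ?subrr //.
rewrite /GRing.scale /= expr1.
by field; rewrite ?pnatr_eq0.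
Qed.

Lemma hessian_V0E x :
  hessian V0 x = diag_mx (\row_i (3 * x 0 i ^+ 2 - 1)).
Proof.
apply/matrixP => i j; rewrite !mxE.
have -> : 'D_(delta_mx 0 j) (@V0 R N) =
    (fun y : 'rV[R]_N => y 0 j) ^+ 3 - (fun y : 'rV[R]_N => y 0 j).
  by apply/funext => y; have /rowP/(_ j) := gradient_V0E y; rewrite !mxE.
have D := fun j => is_derive_coord x (delta_mx 0 i) j.
apply: derive_val; apply: is_derive_eq.
rewrite !mxE eqxx /= /GRing.scale /= eq_sym; case: eqVneq => [->|_] /=.
  by rewrite mulr1 mulr1n.
by rewrite mulr0 subr0 mulr0n.
Qed.
End derivatives.

(** * Diagonal quadratic forms restricted to the zero-sum hyperplane *)

Section diagonal.
Context {R : realType} {N : nat}.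
Implicit Types (d v : 'rV[R]_N) (mu : R).

Definition diag_eigenspace d mu : 'M[R]_N :=
  (@zero_summx R N :&: eigenspace (diag_mx d *m zero_sum_proj) mu)%MS.

Definition diag_index d : nat :=
  \big[addn/0%N]_(mu \in [set mu : R | mu < 0]) \rank (diag_eigenspace d mu).

(** The secular equation [secular d mu = 0] gives the eigenvalues that are not
    entries of [d]. *)
Definition secular d mu : R := \sum_i (d 0 i - mu)^-1.

(** Projecting onto the hyperplane subtracts a constant vector, so being an
    eigenvector only requires [d v - mu v] to be constant. *)
Lemma diag_eigenspaceP d mu v :
  (v <= diag_eigenspace d mu)%MS <->
  zero_sum v /\ exists c, forall i, (d 0 i - mu) * v 0 i = c.
Proof.
have projE (u : 'rV[R]_N) j :
    (u *m zero_sum_proj) 0 j = u 0 j - (\sum_i u 0 i) / N%:R.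
  rewrite mulmxBr mulmx1 !mxE mulr_suml; congr (_ - _).
  by apply: eq_bigr => i _; rewrite mxE.
rewrite /diag_eigenspace sub_capmx; split.
  case/andP => /zero_summxP vS /eigenspaceP; rewrite mulmxA mul_mx_diag => E.
  split=> //; exists ((\sum_i v 0 i * d 0 i) / N%:R) => i.
  move/rowP/(_ i): E; rewrite projE !mxE.
  under eq_bigr do rewrite mxE.
  by move=> /eqP; rewrite subr_eq => /eqP E; rewrite mulrBl mulrC E; ring.
case=> vS [c vc]; apply/andP; split; first exact/zero_summxP.
apply/eigenspaceP; rewrite mulmxA mul_mx_diag; apply/rowP => i.
have N0 : N%:R != 0 :> R by rewrite pnatr_eq0; case: (N) i => // -[].
rewrite projE !mxE.
have -> : \sum_j (\matrix_(i, j) (v i j * d 0 j)) 0 j = N%:R * c :> R.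
  under eq_bigr => j _.
    rewrite mxE (_ : v 0 j * d 0 j = c + mu * v 0 j); last first.
      by rewrite -(vc j); ring.
    over.
  rewrite big_split /= -mulr_sumr vS mulr0 addr0 sumr_const card_ord.
  by rewrite mulr_natl.
by rewrite mulrAC divff // mul1r -(vc i); ring.
Qed.

Lemma rank_sub_rV (m : nat) (A : 'M[R]_(m, N)) (w : 'rV[R]_N) :
  (A <= w)%MS -> (w <= A)%MS -> \rank A = (w != 0).
Proof.
by move=> Aw wA; rewrite (@eqmx_rank _ _ _ _ A w) ?rank_rV //; apply/andP.
Qed.

(** The eigenvectors have coordinates proportional to [(d_i - mu)^-1], so they
    span at most a line, which lies in the hyperplane when the secular equation
    holds. *)
Lemma rank_diag_eigenspace_regular d mu :
  (0 < N)%N -> (forall i, d 0 i != mu) ->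
  \rank (diag_eigenspace d mu) = (secular d mu == 0).
Proof.
move=> N0 dmu; pose w : 'rV[R]_N := \row_i (d 0 i - mu)^-1.
have wsum : \sum_i w 0 i = secular d mu.
  by apply: eq_bigr => i _; rewrite mxE.
have dmu0 i : d 0 i - mu != 0 by rewrite subr_eq0.
have span v : (v <= diag_eigenspace d mu)%MS -> exists c, v = c *: w.
  move=> /diag_eigenspaceP[_ [c vc]]; exists c; apply/rowP => i.
  by rewrite !mxE -(vc i) mulrAC divff ?mul1r.
have w0 : w != 0.
  apply/eqP => /rowP/(_ (Ordinal N0)); rewrite !mxE => /eqP.
  by rewrite invr_eq0 (negPf (dmu0 _)).
case: eqP => [s0|/eqP s0] /=.
  rewrite (@rank_sub_rV _ _ w) ?w0//.
    apply/row_subP => i; have [c ->] := span _ (row_sub i _).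
    exact: scalemx_sub.
  apply/diag_eigenspaceP; split; first by rewrite /zero_sum /= wsum.
  by exists 1 => i; rewrite mxE divff.
apply/eqP; rewrite mxrank_eq0; apply/eqP/row_matrixP => i; rewrite row0.
have [c vc] := span _ (row_sub i _).
have /diag_eigenspaceP[+ _] := row_sub i (diag_eigenspace d mu).
rewrite vc /zero_sum /=; under eq_bigr do rewrite mxE.
rewrite -mulr_sumr wsum => /eqP; rewrite mulf_eq0 (negPf s0) orbF => /eqP ->.
by rewrite scale0r.
Qed.

(** When [mu] is an entry, the constant of [diag_eigenspaceP] vanishes: the
    eigenvectors are the zero-sum vectors supported on the positions of [mu],
    and the differences [e_i - e_i0] of basis vectors form a basis of them. *)
Lemma rank_diag_eigenspace_entry d mu (i0 : 'I_N) : d 0 i0 = mu ->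
  \rank (diag_eigenspace d mu) = #|[set i | d 0 i == mu]%SET|.-1.
Proof.
move=> di0; pose A := [set i | d 0 i == mu]%SET.
have i0A : i0 \in A by rewrite inE di0.
have -> : #|A|.-1 = #|(A :\ i0)%SET| by rewrite (cardsD1 i0 A) i0A.
set B := (A :\ i0)%SET.
pose W : 'M[R]_(#|B|, N) :=
  \matrix_(r < #|B|) (delta_mx 0 (enum_val r) - delta_mx 0 i0).
have Wi r j : W r j = (j == enum_val r)%:R - (j == i0)%:R.
  by rewrite !mxE !eqxx.
have valB (r : 'I_#|B|) : (enum_val r != i0) && (d 0 (enum_val r) == mu).
  by have := enum_valP r; rewrite !inE.
have /eqP <- : row_free W.
  apply/row_freeP; exists (\matrix_(j, s) (j == enum_val s)%:R).
  apply/matrixP => r s; rewrite !mxE.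
  rewrite (bigD1 (enum_val s)) //= big1 => [|j /negPf js]; last first.
    by rewrite [X in _ * X]mxE js mulr0.
  rewrite Wi mxE eqxx mulr1 addr0 (inj_eq enum_val_inj).
  by have /andP[/negPf -> _] := valB s; rewrite subr0 eq_sym.
apply/eqmx_rank/andP; split; apply/row_subP => k.
  have /diag_eigenspaceP[+ [c vc]] := row_sub k (diag_eigenspace d mu).
  move: (row k _) vc => v vc vS.
  have c0 : c = 0 by rewrite -(vc i0) di0 subrr mul0r.
  have vA j : j \notin A -> v 0 j = 0.
    by rewrite inE -subr_eq0 => dj; apply: (mulfI dj); rewrite vc c0 mulr0.
  have vi0 : v 0 i0 = - \sum_(j in B) v 0 j.
    apply/eqP; rewrite -addr_eq0; apply/eqP.
    rewrite -[RHS]vS [RHS](bigID (mem A)) /=.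
    rewrite [X in _ = _ + X]big1 ?addr0 => [|j /vA //].
    by rewrite [RHS](big_setD1 i0).
  suff -> : v = \sum_(r < #|B|) v 0 (enum_val r) *: row r W.
    by apply: summx_sub => r _; apply: scalemx_sub; exact: row_sub.
  apply/rowP => j; rewrite summxE.
  under eq_bigr do rewrite mxE [X in _ * X]mxE Wi.
  rewrite -(big_enum_val (fun i => v 0 i * ((j == i)%:R - (j == i0)%:R))) /=.
  have [->|ji0] := eqVneq j i0.
    rewrite vi0 -sumrN; apply: eq_bigr => i.
    by rewrite !inE eq_sym => /andP[/negPf -> _]; rewrite sub0r mulrN1.
  under eq_bigr do rewrite subr0.
  have [jA|jA] := boolP (j \in A).
    rewrite (bigD1 j) /= ?in_setD1 ?ji0 // eqxx mulr1 big1 ?addr0 // => i.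
    by case/andP=> _; rewrite eq_sym => /negPf ->; rewrite mulr0.
  rewrite vA // big1 // => i; rewrite in_setD1 => /andP[_ iA].
  by rewrite (_ : j == i = false) ?mulr0 //; apply: contraNF jA => /eqP ->.
apply/diag_eigenspaceP; split.
  rewrite /zero_sum /=; under eq_bigr do rewrite mxE Wi.
  have sum_delta l : \sum_j (j == l)%:R = 1 :> R.
    by rewrite (bigD1 l) //= eqxx big1 ?addr0 // => j /negPf ->.
  by rewrite sumrB !sum_delta subrr.
exists 0 => j; rewrite mxE Wi.
have /andP[_ /eqP dk] := valB k.
case: (eqVneq j (enum_val k)) => [->|_]; first by rewrite dk subrr mul0r.
by case: (eqVneq j i0) => [->|_]; rewrite ?di0 ?subrr ?mul0r ?mulr0.
Qed.
End diagonal.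

(** * Diagonal forms with a single negative value *)

Section diagonal_index.
Context {R : realType} {N : nat} (d : 'rV[R]_N) (m : R).
Context (N_gt0 : (0 < N)%N) (m_lt0 : m < 0).
Context (d_entry : forall i, 0 < d 0 i \/ d 0 i = m).

Lemma secular_gt0 mu : (forall i, mu < d 0 i) -> 0 < secular d mu.
Proof.
move=> mud; rewrite /secular (bigD1 (Ordinal N_gt0)) //=.
rewrite ltr_pwDl ?invr_gt0 ?subr_gt0 // sumr_ge0 // => i _.
by rewrite invr_ge0 subr_ge0 ltW.
Qed.

(** Each term increases as long as its argument does not cross the pole: to the
    right of [m], the poles left to cross are all positive. *)
Lemma secular_increasing mu nu :
  m < mu -> mu < nu -> nu <= 0 -> secular d mu < secular d nu.
Proof.
move=> mmu munu nu0; apply: ltr_sum => [|i _].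
  by apply/hasP; exists (Ordinal N_gt0); rewrite ?mem_index_enum.
case: (d_entry i) => [di|->].
  by rewrite ltf_pV2 ?posrE; lra.
by rewrite ltf_nV2 ?negrE; lra.
Qed.

(** The secular function blows up at its pole [m]; multiplying it by [m - mu]
    clears that pole and leaves a continuous function on [[m, 0]], positive at
    [m] and negative at [0], to which the intermediate value theorem applies. *)
Lemma secular_root (i0 : 'I_N) : d 0 i0 = m -> 0 < secular d 0 ->
  exists r, [/\ m < r, r < 0 & secular d r = 0].
Proof.
move=> di0 s0.
(* The value 1 continues (m - mu) / (m - mu) through mu = m. *)
pose G i (mu : R) := if d 0 i == m then 1 else (m - mu) / (d 0 i - mu).
pose F mu := \sum_i G i mu.
have FE mu : mu != m -> F mu = (m - mu) * secular d mu.
  move=> mum; rewrite mulr_sumr; apply: eq_bigr => i _; rewrite /G.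
  by case: eqP => // ->; rewrite divff // subr_eq0 eq_sym.
have Gc i : {in `[m, 0], continuous (G i)}.
  move=> mu; rewrite in_itv /= => /andP[mmu mu0]; rewrite /G.
  case: eqP => [_|dim]; first exact: cvg_cst.
  have di : 0 < d 0 i by case: (d_entry i).
  apply: cvgM; first by apply: cvgB; [exact: cvg_cst | exact: cvg_id].
  apply: cvgV; first by lra.
  by apply: cvgB; [exact: cvg_cst | exact: cvg_id].
have Fc : {within `[m, 0]%classic, continuous F}.
  apply: continuous_in_subspaceT => mu mu0.
  apply: cvg_big => [|i _]; first exact: add_continuous.
  by apply: Gc; move: mu0; rewrite inE.
have Fm : 0 < F m.
  rewrite /F (bigD1 i0) //= {1}/G di0 eqxx.
  rewrite ltr_pwDl ?ltr01 // sumr_ge0 // => i _.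
  by rewrite /G; case: eqP => // _; rewrite subrr mul0r.
have F0 : F 0 < 0.
  by rewrite FE ?subr0 ?nmulr_rlt0 // gt_eqF.
have [|r] := @IVT R F m 0 0 (ltW m_lt0) Fc.
  by rewrite ge_min le_max (ltW F0) (ltW Fm) orbT.
rewrite in_itv /= => /andP[mr r0] Fr; exists r.
have rm : r != m by apply: contraTneq Fm => <-; rewrite Fr ltxx.
have r0' : r != 0 by apply: contraTneq F0 => rE; rewrite -[X in F X]rE Fr ltxx.
split; first by rewrite lt_neqAle eq_sym rm.
  by rewrite lt_neqAle r0'.
move: Fr; rewrite FE // => /eqP.
by rewrite mulf_eq0 subr_eq0 eq_sym (negPf rm) => /eqP.
Qed.

Let k := #|[set i | d 0 i == m]%SET|.

Let secular0 : secular d 0 = \sum_i (d 0 i)^-1.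
Proof. by apply: eq_bigr => i _; rewrite subr0. Qed.

(** To the left of all the entries the secular function is positive, hence has
    no root. When no entry equals [m], this covers every negative [mu]. *)
Lemma rank_diag_eigenspace_below mu :
  mu < 0 -> (k == 0)%N || (mu < m) ->
  \rank (diag_eigenspace d mu) = 0%N.
Proof.
move=> mu0 H.
have lo i : mu < d 0 i.
  case: (d_entry i) => [|di]; first exact: lt_trans.
  case/orP: H => [/eqP/cards0_eq/setP/(_ i)|]; last by rewrite di.
  by rewrite !inE di eqxx.
rewrite rank_diag_eigenspace_regular // => [|i]; last by rewrite gt_eqF.
by rewrite -/(secular d mu) gt_eqF // secular_gt0.
Qed.

Lemma gap_regular mu : m < mu -> mu < 0 -> forall i, d 0 i != mu.
Proof.
move=> mmu mu0 i.
by case: (d_entry i) => [?|->]; [rewrite gt_eqF //; lra | rewrite lt_eqF].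
Qed.

(** The secular function increases on the interval from [m] to [0] up to a
    negative value, so it has no root there: [m] is the only negative
    eigenvalue, with multiplicity [k - 1]. *)
Lemma diag_index_neg : \sum_i (d 0 i)^-1 < 0 -> diag_index d = (k - 1)%N.
Proof.
rewrite -secular0 => s0.
have [k0|k0] := eqVneq k 0%N.
  rewrite k0 /diag_index fsbig1 // => mu mu0.
  by rewrite rank_diag_eigenspace_below // k0.
have [i0] : exists i0, d 0 i0 = m.
  by move: k0; rewrite -lt0n => /card_gt0P[i]; rewrite inE => /eqP; exists i.
move=> di0.
rewrite /diag_index -(fsbig_widen [set m]) ?fsbig_set1
  ?(rank_diag_eigenspace_entry di0) ?subn1 //.
  by move=> mu /= ->.
move=> mu /= [mu0 /eqP mum].
have [mu_m|mmu|/eqP] := ltgtP mu m; last by rewrite (negPf mum).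
  by rewrite rank_diag_eigenspace_below // mu_m orbT.
rewrite /= rank_diag_eigenspace_regular //; last exact: gap_regular.
rewrite -/(secular d mu).
by rewrite lt_eqF // (lt_trans _ s0) // secular_increasing.
Qed.

(** If [m] is an entry, the secular function has exactly one root between [m]
    and [0], which adds one to the multiplicity [k - 1] of [m]. *)
Lemma diag_index_pos : 0 < \sum_i (d 0 i)^-1 -> diag_index d = k.
Proof.
rewrite -secular0 => s0.
have [k0|k0] := eqVneq k 0%N.
  rewrite k0 /diag_index fsbig1 // => mu mu0.
  by rewrite rank_diag_eigenspace_below // k0.
have k1 : (0 < k)%N by rewrite lt0n.
have [i0 di0] : exists i0, d 0 i0 = m.
  by move/card_gt0P: k1 => [i]; rewrite inE => /eqP; exists i.
have [r [mr r0 sr]] := secular_root di0 s0.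
rewrite /diag_index -(fsbig_widen ([set m] `|` [set r])).
- rewrite fsbigU0 ?fsbig_set1 //=.
    rewrite (rank_diag_eigenspace_entry di0) rank_diag_eigenspace_regular //.
      by rewrite -/(secular d r) sr eqxx addn1 prednK.
    exact: gap_regular.
  by move=> mu [/= -> mr']; rewrite mr' ltxx in mr.
- by move=> mu /= [] ->.
move=> mu /= [mu0 /not_orP[/eqP mum /eqP mur]].
have [mu_m|mmu|/eqP] := ltgtP mu m; last by rewrite (negPf mum).
  by rewrite rank_diag_eigenspace_below // mu_m orbT.
rewrite /= rank_diag_eigenspace_regular //; last exact: gap_regular.
rewrite -/(secular d mu).
rewrite -[X in _ == X]sr.
have [?|?|/eqP] := ltgtP mu r; last by rewrite (negPf mur).
  by rewrite lt_eqF // secular_increasing // ltW.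
by rewrite gt_eqF // secular_increasing // ltW.
Qed.
End diagonal_index.

(** * The roots of the multiplier polynomial *)

Section cubic.
Context {R : realType}.
Implicit Types a b c l y : R.

Lemma root_multiplier_polyE l y :
  root (multiplier_poly l) y = (y ^+ 3 - y == l).
Proof. by rewrite /root /multiplier_poly !hornerE subr_eq0. Qed.

(** Subtracting the equations of two roots and dividing by their difference
    gives a quadratic relation; doing so again with two such relations gives
    the vanishing of the sum of the roots. *)
Lemma depressed_cubic_vieta l a b c : uniq [:: a; b; c] ->
  all (root (multiplier_poly l)) [:: a; b; c] ->
  [/\ a + b + c = 0, a * b + b * c + c * a = - 1 &
      forall y, root (multiplier_poly l) y = [|| y == a, y == b | y == c]].
Proof.
rewrite /= !inE negb_or !andbT !root_multiplier_polyE.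
move=> /andP[/andP[ab ac] bc] /and3P[/eqP ra /eqP rb /eqP rc].
have E1 : a ^+ 2 + a * b + b ^+ 2 = 1.
  have ab' : a - b != 0 by rewrite subr_eq0.
  apply: (mulfI ab').
  transitivity (a ^+ 3 - a - (b ^+ 3 - b) + (a - b)); first by ring.
  by rewrite ra rb; ring.
have E2 : a ^+ 2 + a * c + c ^+ 2 = 1.
  have ac' : a - c != 0 by rewrite subr_eq0.
  apply: (mulfI ac').
  transitivity (a ^+ 3 - a - (c ^+ 3 - c) + (a - c)); first by ring.
  by rewrite ra rc; ring.
have S0 : a + b + c = 0.
  have bc' : b - c != 0 by rewrite subr_eq0.
  apply: (mulfI bc').
  transitivity (a ^+ 2 + a * b + b ^+ 2 - (a ^+ 2 + a * c + c ^+ 2));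
    first by ring.
  by rewrite E1 E2; ring.
have cE : c = - a - b by apply/eqP; rewrite -subr_eq0 -S0; apply/eqP; ring.
have e2 : a * b + b * c + c * a = - 1 by rewrite -E1 cE; ring.
split=> // y; rewrite root_multiplier_polyE.
have -> : (y ^+ 3 - y == l) = ((y - a) * ((y - b) * (y - c)) == 0).
  rewrite -subr_eq0; congr (_ == 0).
  transitivity (y ^+ 3 - (a + b + c) * y ^+ 2
    + (a * b + b * c + c * a) * y - a * b * c); last by ring.
  rewrite S0 e2 -ra; suff : a ^+ 3 - a = a * b * c by move=> ->; ring.
  transitivity (a * (a ^+ 2 - 1)); first by ring.
  by rewrite -E1 cE; ring.
by rewrite !mulf_eq0 !subr_eq0.
Qed.

Lemma sum_over_values (N : nat) (x : 'rV[R]_N) (F : R -> R) a b c :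
  uniq [:: a; b; c] -> (forall i, [|| x 0 i == a, x 0 i == b | x 0 i == c]) ->
  \sum_i F (x 0 i) = #|[set i | x 0 i == a]%SET|%:R * F a
    + #|[set i | x 0 i == b]%SET|%:R * F b
    + #|[set i | x 0 i == c]%SET|%:R * F c.
Proof.
rewrite /= !inE negb_or !andbT => /andP[/andP[ab ac] bc] xv.
have part u : #|[set i | x 0 i == u]%SET|%:R * F u =
    \sum_i (if x 0 i == u then F u else 0).
  rewrite -big_mkcond /= sumr_const mulr_natl; congr (_ *+ _).
  by apply: eq_card => i; rewrite !inE.
rewrite !part -!big_split /=; apply: eq_bigr => i _.
case/or3P: (xv i) => /eqP ->; rewrite eqxx.
- by rewrite (negPf ab) (negPf ac) !addr0.
- by rewrite eq_sym (negPf ab) (negPf bc) addr0 add0r.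
- by rewrite ![c == _]eq_sym (negPf ac) (negPf bc) !add0r.
Qed.
End cubic.

(** * Index at a point with given coordinate values *)

Section triple.
Context {R : realType}.
Implicit Types a b c p t : R.

(** Only the coordinates equal to [a] give negative entries of the Hessian, all
    with the same value. *)
Lemma hessian_index_values (N : nat) (x : 'rV[R]_N) a b c :
  (0 < N)%N -> (forall i, [|| x 0 i == a, x 0 i == b | x 0 i == c]) ->
  3 * a ^+ 2 - 1 < 0 -> 0 < 3 * b ^+ 2 - 1 -> 0 < 3 * c ^+ 2 - 1 ->
  let s := \sum_i (3 * x 0 i ^+ 2 - 1)^-1 in
  let k := #|[set i | x 0 i == a]%SET| in
  (0 < s -> hessian_index x = k) /\ (s < 0 -> hessian_index x = (k - 1)%N).
Proof.
move=> N0 xv ha hb hc s k.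
pose d : 'rV[R]_N := \row_i (3 * x 0 i ^+ 2 - 1).
have -> : hessian_index x = diag_index d.
  by rewrite /hessian_index /constrained_eigenspace hessian_V0E.
have dE i : 0 < d 0 i \/ d 0 i = 3 * a ^+ 2 - 1.
  by rewrite mxE; case/or3P: (xv i) => /eqP ->; [right | left | left].
have <- : \sum_i (d 0 i)^-1 = s by apply: eq_bigr => i _; rewrite mxE.
have <- : #|[set i | d 0 i == 3 * a ^+ 2 - 1]%SET| = k.
  apply: eq_card => i; rewrite !inE mxE.
  case/or3P: (xv i) => /eqP xi; rewrite xi ?eqxx //.
    rewrite gt_eqF ?(lt_trans ha) //; apply/esym/negbTE.
    by apply: contraTneq hb => ->; rewrite -leNgt ltW.
  rewrite gt_eqF ?(lt_trans ha) //; apply/esym/negbTE.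
  by apply: contraTneq hc => ->; rewrite -leNgt ltW.
by split; [exact: diag_index_pos | exact: diag_index_neg].
Qed.

(** Two linear relations determine the roots up to a factor; the second Vieta
    relation then turns [3 xi^2 - 1] into a product of differences. *)
Lemma triple_roots p0 p1 p2 a b c : p0 < p2 ->
  a + b + c = 0 -> a * b + b * c + c * a = - 1 ->
  p0 * a + p1 * b + p2 * c = 0 ->
  exists2 t, t != 0 & [/\
    3 * a ^+ 2 - 1 = - (t ^+ 2 * ((2 * p2 - p0 - p1) * (2 * p1 - p0 - p2))),
    3 * b ^+ 2 - 1 = t ^+ 2 * ((2 * p2 - p0 - p1) * (p1 + p2 - 2 * p0)) &
    3 * c ^+ 2 - 1 = t ^+ 2 * ((p1 + p2 - 2 * p0) * (2 * p1 - p0 - p2))].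
Proof.
move=> p02 S0 e2 rel; have p20 : p2 - p0 != 0 by lra.
pose t := b / (p2 - p0).
have bE : b = (p2 - p0) * t by rewrite mulrC divfK.
have cE : c = (p0 - p1) * t.
  apply: (mulfI p20).
  transitivity (p0 * a + p1 * b + p2 * c - p0 * (a + b + c) - (p1 - p0) * b);
    first by ring.
  by rewrite rel S0 bE; ring.
have aE : a = (p1 - p2) * t.
  transitivity (a + b + c - b - c); first by ring.
  by rewrite S0 bE cE; ring.
have m1 : -1 = a * b + b * c + c * a by rewrite e2.
exists t; last by rewrite m1 aE bE cE; split; ring.
apply: contra_eq_neq m1 => t0; rewrite aE bE cE t0 !mulr0 !addr0.
by rewrite oppr_eq0 oner_eq0.
Qed.

(** Over a common denominator, the numerator is the sum of the squares of the
    differences of the [p_j]; as [A] and [B] are positive for a triple, the sign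
    is that of [C]. *)
Lemma sum_inv_triple p0 p1 p2 t :
  let A := 2 * p2 - p0 - p1 in let B := p1 + p2 - 2 * p0 in
  let C := 2 * p1 - p0 - p2 in
  t != 0 -> A != 0 -> B != 0 -> C != 0 ->
  p0 * (- (t ^+ 2 * (A * C)))^-1 + p1 * (t ^+ 2 * (A * B))^-1
    + p2 * (t ^+ 2 * (B * C))^-1 =
  ((p0 - p1) ^+ 2 + (p1 - p2) ^+ 2 + (p2 - p0) ^+ 2)
    / (t ^+ 2 * (A * B)) / C.
Proof.
move=> A B C t0 A0 B0 C0; rewrite /A /B /C in A0 B0 C0 *; field.
by rewrite t0 A0 B0 C0.
Qed.

End triple.

Theorem proposition3p1 (R : realType) (N : nat) (hN : (2 <= N)%N)
  (hN3 : ~~ (3 %| N)%N) (x : 'rV[R]_N) (a0 a1 a2 : nat)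
  (hx : stationary x) (ha : has_triple x a0 a1 a2) :
  ((a0 + a2 < 2 * a1)%N -> hessian_index x = a0) /\
  ((2 * a1 < a0 + a2)%N -> hessian_index x = (a2 - 1)%N).
Proof.
have N0 : (0 < N)%N := ltnW hN.
case: hx => xS _.
case: ha => l [a [b [c [xl [abc rabc] [E0 E1 E2] /andP[a01 a12]]]]].
have [S0 e2 rootE] := depressed_cubic_vieta abc rabc.
have xv i : [|| x 0 i == a, x 0 i == b | x 0 i == c].
  rewrite -rootE root_multiplier_polyE; apply/eqP.
  by have /rowP/(_ i) := xl; rewrite gradient_V0E !mxE.
have sumE F := sum_over_values F abc xv.
rewrite -E0 -E1 -E2 in sumE.
have NE : (N = a0 + a1 + a2)%N.
  apply/eqP; rewrite -(eqr_nat R) !natrD; apply/eqP.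
  have := sumE (fun=> 1); rewrite sumr_const card_ord => ->.
  by rewrite !mulr1.
(* Three equal counts would add up to a multiple of 3. *)
have a02 : (a0 < a2)%N.
  rewrite ltn_neqAle (leq_trans a01 a12) andbT; apply: contra hN3 => /eqP a02.
  have a1E : a1 = a0 by lia.
  by rewrite NE a1E -a02; apply/dvdnP; exists a0; lia.
have rel : a0%:R * a + a1%:R * b + a2%:R * c = 0 by rewrite -(sumE id).
have p02 : a0%:R < a2%:R :> R by rewrite ltr_nat.
have p01 : a0%:R <= a1%:R :> R by rewrite ler_nat.
have p12 : a1%:R <= a2%:R :> R by rewrite ler_nat.
have [t t0 [ha hb hc]] := triple_roots p02 S0 e2 rel.
have := sumE (fun y => (3 * y ^+ 2 - 1)^-1).
rewrite ha hb hc.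
have := @sum_inv_triple R a0%:R a1%:R a2%:R t; cbv zeta.
set A := 2 * a2%:R - _ - _ in ha hb *.
set B := a1%:R + a2%:R - _ in hb hc *.
set C := 2 * a1%:R - _ - _ in ha hc *.
move=> /(_ t0) sE sumh.
have A0 : 0 < A by rewrite /A; lra.
have B0 : 0 < B by rewrite /B; lra.
have t2 : 0 < t ^+ 2 by rewrite exprn_even_gt0.
have Q0 : 0 < ((a0%:R - a1%:R) ^+ 2 + (a1%:R - a2%:R) ^+ 2
    + (a2%:R - a0%:R) ^+ 2) / (t ^+ 2 * (A * B)).
  apply: divr_gt0; last exact: mulr_gt0 t2 (mulr_gt0 A0 B0).
  rewrite ltr_wpDl ?addr_ge0 ?sqr_ge0 // exprn_even_gt0 //=.
  by rewrite subr_eq0 gt_eqF.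
have hb0 : 0 < 3 * b ^+ 2 - 1.
  by rewrite hb; exact: mulr_gt0 t2 (mulr_gt0 A0 B0).
have CE n : (2 * n)%:R = 2 * n%:R :> R by rewrite natrM.
split=> mid.
  have C0 : 0 < C.
    by move: mid; rewrite -(ltr_nat R) natrD CE /C => mid; lra.
  have ha0 : 3 * a ^+ 2 - 1 < 0.
    by rewrite ha oppr_lt0; exact: mulr_gt0 t2 (mulr_gt0 A0 C0).
  have hc0 : 0 < 3 * c ^+ 2 - 1.
    by rewrite hc; exact: mulr_gt0 t2 (mulr_gt0 B0 C0).
  have [pos _] := hessian_index_values N0 xv ha0 hb0 hc0.
  by rewrite E0; apply: pos; rewrite sumh sE ?gt_eqF // divr_gt0.
have C0 : C < 0.
  by move: mid; rewrite -(ltr_nat R) natrD CE /C => mid; lra.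
have hc0 : 3 * c ^+ 2 - 1 < 0 by rewrite hc !pmulr_rlt0.
have ha0 : 0 < 3 * a ^+ 2 - 1 by rewrite ha oppr_gt0 !pmulr_rlt0.
have xv' i : [|| x 0 i == c, x 0 i == a | x 0 i == b].
  by case/or3P: (xv i) => ->; rewrite ?orbT.
have [_ neg] := hessian_index_values N0 xv' hc0 ha0 hb0.
rewrite E2; apply: neg.
rewrite sumh sE ?(gt_eqF A0) ?(gt_eqF B0) ?(lt_eqF C0) //.
by rewrite pmulr_rlt0 // invr_lt0.
Qed.
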